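(* Suppose Problem (P2) (described in the context) has a solution. Then Algorithm OFFM (described in the context) returns an optimal solution to Problem (P2).
   Context: Model. Energy arrives at a transmitter at instants $0=\tau_0<\tau_1<\cdots$ in amounts $\mathcal{E}_i>0$; $\mathcal{E}(t)=\sum_{i:\tau_i\le t}\mathcal{E}_i$. Energy also arrives at the receiver at instants $0=r_0<r_1<\cdots$; the $i$-th receiver arrival adds an amount $\Gamma_i>0$ of receiver on-time (harvested energy divided by the constant on-power $P_r$); $\Gamma(t)=\sum_{i:r_i\le t}\Gamma_i$. All arrivals are known in advance (offline setting) and batteries are infinite. Rate function. $g:[0,\infty)\to[0,\infty)$ is monotonically increasing, $g(0)=0$, $\lim_{p\to\infty}g(p)=\infty$, $g$ is concave, and $g(p)/p$ is convex and monotonically decreasing with $\lim_{p\to\infty}g(p)/p=0$. Policies. A policy $\{\bm p,\bm s,N\}$ has powers $p_1,\dots,p_N\ge0$ and times $0\le s_1<\cdots<s_{N+1}$; power $p_i$ is used on $[s_i,s_{i+1}]$ and the receiver is on exactly when the power is nonzero. $U(t)$, $B(t)$, $C(t)$ are, respectively, the energy used, the bits sent (at rate $g(\text{power})$) and the receiver on-time used up to time $t$. The start time is $s_1$. Problem (P2): given $B_0>0$, minimize $T=s_{N+1}$ subject to $B(T)=B_0$, $U(t)\le\mathcal{E}(t)$ and $C(t)\le\Gamma(t)$ for all $t\in[0,T]$. For each $i$, $O_i\ge0$ is the earliest time such that the receiver can be kept on continuously from $O_i$ to $O_i+\Gamma(r_i)$ without violating $C(t)\le\Gamma(t)$. Let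 $i_0=\min\{i:\lim_{t\to\infty}\Gamma(r_i)\,g(\mathcal{E}(t)/\Gamma(r_i))\ge B_0\}$. For $i\ge i_0$, Problem OFF$(O_i)$: minimize $T=s_{N+1}$ subject to $B(T)=B_0$; $U(t)\le\mathcal{E}(t)$ and $C(t)\le\Gamma(r_i)$ for all $t\in[O_i,T]$; $U(t)=C(t)=0$ for $t\in[0,O_i]$. (This is a problem with a single receiver on-time arrival $\Gamma(r_i)$ at time $O_i$.) $X_i$ denotes the optimal policy without breaks (all $p_j>0$) of OFF$(O_i)$; it is computed by a subroutine, Algorithm OFF, which returns an optimal policy for problems with a single receiver arrival. Algorithm OFFM. Initialize $i=i_0$. Step 1: compute $X_i$. Step 2: if the start time of $X_i$ is at most $O_{i+1}$, output $X_i$ and terminate; otherwise increase $i$ by $1$ and go to Step 1. *)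

(* Defs.v *)
From mathcomp Require Export all_boot all_order all_algebra.
From mathcomp Require Export all_classical all_reals all_analysis.

Set Implicit Arguments.
Unset Strict Implicit.
Unset Printing Implicit Defensive.

Import Order.TTheory GRing.Theory Num.Theory.
Import numFieldNormedType.Exports.

Local Open Scope classical_set_scope.
Local Open Scope ring_scope.

Section Arrivals.
Variable R : realType.

(* The divergence of the instants says that finitely many arrivals occur in
   bounded time, which is what makes the sum in [cumulative] meaningful. *)
Definition arrival_process (time amount : nat -> R) : Prop :=
  [/\ time 0%N = 0,
      forall i, time i < time i.+1,
      time n @[n --> \oo] --> +oo
    & forall i, 0 < amount i].

(* The sum over [i \in A] is the library's sum over a finite support; it would
   be 0 by convention if infinitely many instants were at most t. *)
Definition cumulative (time amount : nat -> R) (t : R) : R :=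
  \sum_(i \in [set i : nat | time i <= t]) amount i.

End Arrivals.

Section RateFunction.
Variable R : realType.

(* Monotonicity is only required in the weak sense.  The quotient g(p)/p is
   considered for p > 0; the rate function is only constrained on [0, +oo[. *)
Definition rate_function (g : R -> R) : Prop :=
  [/\ g 0 = 0 /\ (forall p : R, 0 <= p -> 0 <= g p),
      {in `[0, +oo[ &, {homo g : p q / p <= q}} /\ g p @[p --> +oo] --> +oo,
      convex_function (`[0, +oo[%classic : set R) (fun p => - g p),
      convex_function (`]0, +oo[%classic : set R) (fun p => g p / p)
    & {in `]0, +oo[ &, {homo (fun p => g p / p) : p q / p <= q >-> q <= p}} /\
      g p / p @[p --> +oo] --> 0].

End RateFunction.

Section Policies.
Variable R : realType.

(* Pieces are numbered from 0: power [pw j] is used on [sw j, sw j.+1] for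
   j < npieces.  Values of [pw] beyond npieces - 1 and of [sw] beyond npieces
   are irrelevant. *)
Record policy := Policy {
  npieces : nat;
  pw : nat -> R;
  sw : nat -> R
}.

Implicit Type x : policy.

Definition policy_wf x : Prop :=
  [/\ 0 <= sw x 0,
      forall j, (j < npieces x)%N -> sw x j < sw x j.+1
    & forall j, (j < npieces x)%N -> 0 <= pw x j].

Definition start_time x : R := sw x 0.
Definition finish_time x : R := sw x (npieces x).

(* length of [sw x j, sw x j.+1] `&` [0, t] *)
Definition elapsed x (j : nat) (t : R) : R :=
  Num.max 0 (Num.min t (sw x j.+1) - sw x j).

Definition energy_used x (t : R) : R :=
  \sum_(j < npieces x) pw x j * elapsed x j t.

Definition bits_sent (g : R -> R) x (t : R) : R :=
  \sum_(j < npieces x) g (pw x j) * elapsed x j t.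

Definition ontime_used x (t : R) : R :=
  \sum_(j < npieces x | pw x j != 0) elapsed x j t.

Definition without_breaks x : Prop :=
  forall j, (j < npieces x)%N -> 0 < pw x j.

Definition optimal (feasible : policy -> Prop) x : Prop :=
  feasible x /\ forall y, feasible y -> finish_time x <= finish_time y.

End Policies.

Section Problems.
Variables (R : realType) (g : R -> R) (B0 : R).
(* cumulative transmitter energy and cumulative receiver on-time *)
Variables (E Gam : R -> R).
(* receiver arrival instants *)
Variable r : nat -> R.

Definition P2_feasible (x : policy R) : Prop :=
  [/\ policy_wf x,
      bits_sent g x (finish_time x) = B0
    & forall t, 0 <= t <= finish_time x ->
        energy_used x t <= E t /\ ontime_used x t <= Gam t].

(* a single receiver arrival, of amount G, at time o *)
Definition OFF_feasible (o G : R) (x : policy R) : Prop :=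
  [/\ policy_wf x,
      bits_sent g x (finish_time x) = B0,
      forall t, o <= t <= finish_time x ->
        energy_used x t <= E t /\ ontime_used x t <= G
    & forall t, 0 <= t <= o -> energy_used x t = 0 /\ ontime_used x t = 0].

(* With the receiver on from o, the on-time used up to t is t - o. *)
Definition continuously_on_from (i : nat) : set R :=
  [set o | 0 <= o /\
     forall t, o <= t <= o + Gam (r i) -> t - o <= Gam t].

Definition earliest_on_time (i : nat) (o : R) : Prop :=
  continuously_on_from i o /\ lbound (continuously_on_from i) o.

(* The limit is taken in the extended reals, since E may be unbounded. *)
Definition enough_bits (i : nat) : Prop :=
  (B0%:E <= lim ((Gam (r i) * g (E t / Gam (r i)))%:E @[t --> +oo%R]))%E.

Definition first_index (i0 : nat) : Prop :=
  enough_bits i0 /\ forall i, enough_bits i -> (i0 <= i)%N.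

Variable O : nat -> R.

(* What the subroutine returns on OFF(O_i), i >= i0; None reports that this
   problem admits no policy at all.  (This can happen for i >= i0, when the
   limit in [enough_bits] equals B0 without being attained.) *)
Definition OFF_subroutine (X : nat -> option (policy R)) : Prop :=
  forall i0 i, first_index i0 -> (i0 <= i)%N ->
    match X i with
    | Some x => optimal (OFF_feasible (O i) (Gam (r i))) x /\ without_breaks x
    | None => ~ exists x, OFF_feasible (O i) (Gam (r i)) x
    end.

Variable X : nat -> option (policy R).

Definition stop_at (i : nat) (x : policy R) : Prop :=
  X i = Some x /\ start_time x <= O i.+1.

(* [OFFM_loop i x]: the loop entered with index i terminates with output x. *)
Inductive OFFM_loop : nat -> policy R -> Prop :=
| OFFM_output i x : stop_at i x -> OFFM_loop i x
| OFFM_next i x :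
    (forall y, ~ stop_at i y) -> OFFM_loop i.+1 x -> OFFM_loop i x.

Definition OFFM_returns (x : policy R) : Prop :=
  exists2 i0, first_index i0 & OFFM_loop i0 x.

End Problems.

(* Main.v *)
Require Import Defs.
From mathcomp Require Import ring lra.

Import Order.TTheory GRing.Theory Num.Theory.
Import numFieldNormedType.Exports.
Local Open Scope ring_scope.

Set Implicit Arguments.
Unset Strict Implicit.
Unset Printing Implicit Defensive.

(* Delaying everything that precedes a break removes the break, so every (P2)
   policy can be replaced by one without breaks; the latter solves OFF(O_j) for
   the first j such that Gam(r_j) covers its duration.  Conversely every X_j
   solves (P2), so (P2) amounts to minimizing the finish time of X_j over j.
   While the loop goes on, X_i still solves OFF(O_{i+1}), so finish times do not
   increase.  If X_i starts by O_{i+1}, then a later X_j starts after X_i does;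
   finishing earlier too, it would be shorter and would solve OFF(O_i) better
   than X_i. *)

(** * Arrival processes and their cumulative sums *)

Section Cumulative.
Variables (R : realType) (time amount : nat -> R).
Hypothesis arr : arrival_process time amount.

Let amount_gt0 i : 0 < amount i. Proof. by case: arr. Qed.
Let time0 : time 0%N = 0. Proof. by case: arr. Qed.

Lemma arrival_time_le : {mono time : i j / (i <= j)%N >-> i <= j}.
Proof.
have lt_time : {homo time : i j / (i < j)%N >-> i < j}.
  by apply: homo_ltn => [x y z|]; [exact: lt_trans | case: arr].
move=> i j; case: (ltngtP i j) => [/lt_time/ltW//|/lt_time|->]; last exact: lexx.
by rewrite ltNge => /negbTE.
Qed.

Lemma arrival_time_unbounded (c : R) : exists m, forall i, (m <= i)%N -> c < time i.
Proof.
case: arr => _ _ /cvgryPgt/(_ c) [m _ lt_c] _.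
by exists m => i mi; exact: lt_c.
Qed.

(** Instants increase and diverge, so the arrivals up to [t] form an initial segment of the indices.
    This turns the finite-support sum in [cumulative] into an ordinary one. *)
Lemma arrivals_before (t : R) : exists n, forall i, (time i <= t) = (i < n)%N.
Proof.
have [m lt_t] := arrival_time_unbounded t.
have ex : exists n, t < time n by exists m; exact: lt_t.
exists (ex_minn ex) => i; case: ex_minnP => n t_n min_n.
have [i_n|n_i] := ltnP i n.
  by rewrite leNgt; apply/negP => /min_n; rewrite leqNgt i_n.
by apply/negbTE; rewrite -ltNge (lt_le_trans t_n)// arrival_time_le.
Qed.

Lemma cumulativeE (t : R) n : (forall i, (time i <= t) = (i < n)%N) ->
  cumulative time amount t = \sum_(i < n) amount i.
Proof.
move=> tn; rewrite /cumulative.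
have -> : [set i | time i <= t]%classic = `I_n.
  by apply/seteqP; split=> i /=; rewrite tn.
by rewrite fsbig_ord.
Qed.

Lemma cumulative_arrival k :
  cumulative time amount (time k) = \sum_(i < k.+1) amount i.
Proof. by apply: cumulativeE => i; rewrite arrival_time_le. Qed.

Lemma cumulative_arrival_lt k :
  cumulative time amount (time k) < cumulative time amount (time k.+1).
Proof. by rewrite !cumulative_arrival [ltRHS]big_ord_recr/= ltrDl. Qed.

Lemma le_partial_sum m n : (m <= n)%N ->
  \sum_(i < m) amount i <= \sum_(i < n) amount i.
Proof.
elim: n => [|n IH]; first by rewrite leqn0 => /eqP ->.
rewrite leq_eqVlt => /predU1P[->//|]; rewrite ltnS => /IH le_mn.
by rewrite big_ord_recr/= (le_trans le_mn)// lerDl ltW.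
Qed.

Lemma le_cumulative (t t' : R) : t <= t' ->
  cumulative time amount t <= cumulative time amount t'.
Proof.
move=> tt'; have [m tm] := arrivals_before t; have [n tn] := arrivals_before t'.
rewrite (cumulativeE tm) (cumulativeE tn); apply: le_partial_sum.
case: m tm => // m tm; rewrite -tn (le_trans _ tt')//.
by rewrite tm.
Qed.

Lemma cumulative_before k (t : R) : t < time k.+1 ->
  cumulative time amount t <= cumulative time amount (time k).
Proof.
move=> tk; have [n tn] := arrivals_before t.
rewrite (cumulativeE tn) cumulative_arrival; apply: le_partial_sum.
by rewrite leqNgt -tn -ltNge.
Qed.

Lemma cumulative_gt0 (t : R) : 0 <= t -> 0 < cumulative time amount t.
Proof.
move=> t0; apply: lt_le_trans (le_cumulative t0).
by rewrite -[X in cumulative _ _ X]time0 cumulative_arrival big_ord1.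
Qed.

End Cumulative.

(** * Concavity of the rate function and strict decrease of [g p / p] *)

Lemma convex_function_le (R : realType) (D : set R) (f : R -> R) (t p q : R) :
  convex_function (D : set R^o) f -> 0 <= t <= 1 -> D p -> D q ->
  f (t * p + (1 - t) * q) <= t * f p + (1 - t) * f q.
Proof.
move=> conv t01 Dp Dq.
have t01' : Itv.spec (Itv.num_sem (R := R)) (Itv.Real `[0%Z, 1%Z]) t.
  by rewrite /Itv.spec /Itv.num_sem /= num_real in_itv.
by apply: (conv (Itv.mk t01')); rewrite inE.
Qed.

Section RateFunctionTheory.
Variables (R : realType) (g : R -> R).
Hypothesis rate : rate_function g.

Let g0 : g 0 = 0. Proof. by case: rate => [[]]. Qed.

Lemma le_rate p q : 0 <= p -> p <= q -> g p <= g q.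
Proof.
case: rate => _ [mono _] _ _ _ p0 pq.
by apply: mono; rewrite // in_itv/= andbT//; exact: le_trans pq.
Qed.

(** Concavity with unnormalized weights: [a] and [b] are durations, and averaging the power over
    [a + b] does not lose bits. *)
Lemma rate_concave a b p q : 0 <= a -> 0 <= b -> 0 < a + b -> 0 <= p -> 0 <= q ->
  a * g p + b * g q <= (a + b) * g ((a * p + b * q) / (a + b)).
Proof.
move=> a0 b0 ab p0 q0; case: rate => _ _ conc _ _.
have := @convex_function_le _ _ _ (a / (a + b)) p q conc.
rewrite /= !in_itv/= !andbT divr_ge0 ?addr_ge0//= ler_pdivrMr// mul1r lerDl.
move=> /(_ b0 p0 q0).
have ab0 : a + b != 0 by rewrite gt_eqF.
have -> : 1 - a / (a + b) = b / (a + b) by field.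
have -> : a / (a + b) * p + b / (a + b) * q = (a * p + b * q) / (a + b) by field.
have -> : a / (a + b) * - g p + b / (a + b) * - g q =
   - ((a * g p + b * g q) / (a + b)) by field.
by rewrite lerN2 ler_pdivrMr// (mulrC (g _) (a + b)).
Qed.

(** [g] tends to infinity, so it is positive at some [q > p]; concavity between 0 and [q] gives
    [p * g q <= q * g p]. *)
Lemma rate_gt0 p : 0 < p -> 0 < g p.
Proof.
move=> p0; case: rate => _ [_ /cvgryPgt/(_ 0)[A [_ gA]]] _ _ _.
pose q := Num.max A p + 1.
have pq : p < q by rewrite /q; case: (leP A p) => ?; lra.
have gq : 0 < g q by apply: gA; rewrite /q; case: (leP A p) => ?; lra.
have := @rate_concave p (q - p) q 0.
rewrite g0 !mulr0 !addr0 (addrC p (q - p)) subrK.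
have -> : p * q / q = p by field; rewrite gt_eqF// (lt_trans p0).
move=> H; have {H} : p * g q <= q * g p by apply: H; lra.
have := mulr_gt0 p0 gq => h1 h2.
by rewrite -(pmulr_rgt0 _ (lt_trans p0 pq)) (lt_le_trans h1).
Qed.

(** If the quotient took the same value [c > 0] at [p] and [q], then at some [z > q] it would be
    below [c], as it tends to 0. Convexity between [p] and [z] would then put its value at [q]
    strictly below [c]. *)
Lemma rate_quotient_lt p q : 0 < p -> p < q -> g q / q < g p / p.
Proof.
move=> p0 pq; have q0 := lt_trans p0 pq.
case: rate => _ _ _ conv [mono lim0].
rewrite lt_neqAle mono ?in_itv/= ?p0 ?q0 ?ltW// andbT; apply/negP => /eqP eq_pq.
pose c := g q / q.
have c0 : 0 < c by rewrite divr_gt0// rate_gt0.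
have [A [_ hA]] : \forall x \near +oo, g x / x < c.
  by move/cvgr_lt: lim0; apply.
pose z := Num.max A q + 1.
have qz : q < z by rewrite /z; case: (leP A q) => ?; lra.
have gz : g z / z < c by apply: hA; rewrite /z; case: (leP A q) => ?; lra.
have zp : 0 < z - p by lra.
have := @convex_function_le _ _ _ ((z - q) / (z - p)) p z conv.
rewrite /= !in_itv/= !andbT divr_ge0 ?(ltW zp) ?subr_ge0 ?(ltW qz)//=.
rewrite ler_pdivrMr// mul1r lerB ?(ltW pq)// => /(_ isT p0 (lt_trans q0 qz)).
have zp0 : z - p != 0 by rewrite gt_eqF.
have -> : 1 - (z - q) / (z - p) = (q - p) / (z - p) by field.
have -> : (z - q) / (z - p) * p + (q - p) / (z - p) * z = q by field.
rewrite -eq_pq -/c => le_c.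
have : (q - p) / (z - p) * (g z / z) < (q - p) / (z - p) * c.
  by rewrite ltr_pM2l// divr_gt0// subr_gt0.
have : (z - q) / (z - p) * c + (q - p) / (z - p) * c = c by field.
lra.
Qed.

(** Jensen's inequality for durations [d j] whose sum may fall short of [L]: the slack counts as
    time at power 0, where [g] vanishes. The induction leaves [L - d n] to the first [n] pieces. *)
Lemma rate_jensen n (p d : nat -> R) (L : R) : 0 < L ->
  (forall j, (j < n)%N -> 0 <= p j) -> (forall j, (j < n)%N -> 0 <= d j) ->
  \sum_(j < n) d j <= L ->
  \sum_(j < n) g (p j) * d j <= L * g ((\sum_(j < n) p j * d j) / L).
Proof.
elim: n L => [|n IH] L L0 p0 d0.
  by rewrite !big_ord0 mul0r g0 mulr0.
rewrite !big_ord_recr/= => le_L.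
have pn0 := p0 n (ltnSn n); have dn0 := d0 n (ltnSn n).
have {}p0 j : (j < n)%N -> 0 <= p j by move=> jn; exact: p0 (ltnW _).
have {}d0 j : (j < n)%N -> 0 <= d j by move=> jn; exact: d0 (ltnW _).
have S0 : 0 <= \sum_(j < n) d j by apply: sumr_ge0 => j _; exact: d0.
have U0 : 0 <= \sum_(j < n) p j * d j.
  by apply: sumr_ge0 => j _; rewrite mulr_ge0 ?p0 ?d0.
have [L'0|] := ltP 0 (L - d n).
  have := IH _ L'0 p0 d0; rewrite lerBrDr => /(_ le_L) le1.
  have := @rate_concave (L - d n) (d n) ((\sum_(j < n) p j * d j) / (L - d n)) (p n).
  rewrite subrK (mulrC (L - d n) (_ / _)) mulfVK ?gt_eqF//.
  move=> /(_ (ltW L'0) dn0 L0 (divr_ge0 U0 (ltW L'0)) pn0).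
  rewrite (mulrC (d n) (p n)) (mulrC (d n) (g _)).
  by apply: le_trans; rewrite lerD2r.
(* Here the last piece fills all of [L], and the other durations vanish. *)
move=> L'0; have S_eq0 : \sum_(j < n) d j = 0 by apply/le_anti; rewrite S0 andbT; lra.
have dL : d n = L by lra.
have dj0 (j : 'I_n) : d j = 0.
  apply/le_anti; rewrite d0// andbT -S_eq0 (bigD1 j)//= lerDl.
  by apply: sumr_ge0 => k _; exact: d0.
rewrite big1 => [|j _]; last by rewrite dj0 mulr0.
rewrite big1 => [|j _]; last by rewrite dj0 mulr0.
by rewrite !add0r dL mulfK ?gt_eqF// mulrC.
Qed.

(** The expression under the limit is nondecreasing in time, so its limit exists in the extended
    reals and dominates each of its values. *)
Lemma enough_bitsP (tau en r : nat -> R) (Gam : R -> R) (B0 : R) i t :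
  arrival_process tau en -> 0 < Gam (r i) -> 0 <= t ->
  B0 <= Gam (r i) * g (cumulative tau en t / Gam (r i)) ->
  enough_bits g B0 (cumulative tau en) Gam r i.
Proof.
move=> arr G0 t0 le_B.
set F := fun t => Gam (r i) * g (cumulative tau en t / Gam (r i)).
have E0 u : 0 <= cumulative tau en u.
  have [n un] := arrivals_before arr u; rewrite (cumulativeE en un).
  by case: arr => _ _ _ en0; apply: sumr_ge0 => j _; exact: ltW.
have F_homo : {homo (fun u => (F u)%:E) : u v / u <= v >-> (u <= v)%E}.
  move=> u v uv; rewrite lee_fin /F ler_pM2l// le_rate ?divr_ge0 ?(ltW G0)//.
  by rewrite ler_pM2r ?invr_gt0// le_cumulative.
apply: lime_ge; first exact: (nondecreasing_is_cvge F_homo).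
near=> u; apply: (@le_trans _ _ (F t)%:E); first by rewrite lee_fin.
by apply: F_homo; near: u; exact: nbhs_pinfty_ge (num_real t).
Unshelve. all: by end_near.
Qed.

End RateFunctionTheory.

(** * Elapsed time and usage of a policy *)

Section PolicyTheory.
Variable R : realType.
Implicit Types (x : policy R) (f : R -> R) (t : R).

(* Energy, bits and on-time are [usage f] for f p = p, g p and [p != 0]. *)
Definition usage f x t : R := \sum_(j < npieces x) f (pw x j) * elapsed x j t.

Lemma ontime_usedE x t : ontime_used x t = usage (fun p => (p != 0)%:R) x t.
Proof.
rewrite /ontime_used /usage big_mkcond; apply: eq_bigr => j _.
by case: eqP => _; rewrite ?mul0r ?mul1r.
Qed.

Lemma elapsed_ge0 x j t : 0 <= elapsed x j t.
Proof. by rewrite le_max lexx. Qed.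

Lemma elapsed_before x j t : t <= sw x j -> elapsed x j t = 0.
Proof.
by move=> tj; apply/max_idPl; rewrite subr_le0 ge_min tj.
Qed.

Lemma elapsed_after x j t :
  sw x j <= sw x j.+1 <= t -> elapsed x j t = sw x j.+1 - sw x j.
Proof.
by move=> /andP[jj jt]; rewrite /elapsed (min_idPr jt); apply/max_idPr; rewrite subr_ge0.
Qed.

Lemma le_sw x i j : policy_wf x -> (i <= j <= npieces x)%N -> sw x i <= sw x j.
Proof.
move=> [_ lt_sw _]; elim: j => [|j IH]; first by rewrite leqn0 => /andP[/eqP ->].
move=> /andP[]; rewrite leq_eqVlt => /predU1P[->//|]; rewrite ltnS => ij jN.
by rewrite (le_trans (IH _)) ?ij ?(ltW (lt_sw _ _))// ltnW.
Qed.

Lemma elapsed_finish x j : policy_wf x -> (j < npieces x)%N ->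
  elapsed x j (finish_time x) = sw x j.+1 - sw x j.
Proof. by move=> wf jN; apply: elapsed_after; rewrite !le_sw// ?leqnSn ?jN ?leqnn. Qed.

(** The pieces are contiguous, so the lengths telescope; the case splits only resolve the minima and
    maxima. *)
Lemma sum_elapsed x n t : policy_wf x -> (n <= npieces x)%N ->
  \sum_(j < n) elapsed x j t = Num.max 0 (Num.min t (sw x n) - sw x 0).
Proof.
move=> wf; elim: n => [_|n IH nN].
  rewrite big_ord0; symmetry; apply/max_idPl.
  by rewrite subr_le0 ge_min lexx orbT.
rewrite big_ord_recr/= IH 1?ltnW// /elapsed.
have := @le_sw _ 0 n wf; rewrite leq0n ltnW// => /(_ isT).
have : sw x n < sw x n.+1 by case: wf => _ + _; apply.
move: (sw x 0) (sw x n) (sw x n.+1) => a b c.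
case: (leP t b); case: (leP t c) => ? ? ? ?.
- by case: (leP 0 (t - a)); case: (leP 0 (t - b)); lra.
- lra.
- by case: (leP 0 (b - a)); case: (leP 0 (t - b)); case: (leP 0 (t - a)); lra.
- by case: (leP 0 (b - a)); case: (leP 0 (c - b)); case: (leP 0 (c - a)); lra.
Qed.

Lemma ontime_without_breaks x t : policy_wf x -> without_breaks x ->
  ontime_used x t = Num.max 0 (Num.min t (finish_time x) - start_time x).
Proof.
move=> wf pos; rewrite /ontime_used -sum_elapsed//.
by apply: eq_bigl => j; rewrite gt_eqF ?pos.
Qed.

(** * Removing one piece while keeping the finish time *)

Definition drop_piece (k : nat) x : policy R :=
  Policy (npieces x).-1 (fun j => pw x (bump k j))
    (fun j => if (j <= k)%N then sw x j + (sw x k.+1 - sw x k) else sw x j.+1).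

Section DropPiece.
Variables (x : policy R) (k : nat).
Hypotheses (wf : policy_wf x) (kN : (k < npieces x)%N).

Let len_gt0 : 0 < sw x k.+1 - sw x k.
Proof. by rewrite subr_gt0; case: wf => _ + _; exact. Qed.

Lemma npieces_drop : npieces x = (npieces (drop_piece k x)).+1.
Proof. by rewrite /= prednK//; case: (npieces x) kN. Qed.

(** The two branches agree at [j = k]. With the strict test, both ends of piece [j] are decided by
    [j < k], since the test for [j.+1] in [drop_piece] is [j.+1 <= k]. *)
Lemma sw_drop j :
  sw (drop_piece k x) j = if (j < k)%N then sw x j + (sw x k.+1 - sw x k)
                          else sw x j.+1.
Proof. by rewrite /=; case: ltngtP => // ->; rewrite addrC subrK. Qed.

Lemma drop_piece_wf : policy_wf (drop_piece k x).
Proof.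
case: (wf) => s0 lt_sw pw0; split=> [|j|j].
- by rewrite /= addr_ge0// ltW.
- move=> jN; have jN' : (j.+1 < npieces x)%N by rewrite npieces_drop.
  rewrite sw_drop [X in _ < X]/=; case: ltnP => jk; last exact: lt_sw.
  by rewrite ltrD2r lt_sw// ltnW.
- move=> jN; apply: pw0; rewrite npieces_drop /bump; case: (leqP k j) => _ //.
  by rewrite add0n ltnS ltnW.
Qed.

Lemma finish_drop : finish_time (drop_piece k x) = finish_time x.
Proof.
by rewrite /finish_time sw_drop -npieces_drop leqNgt kN.
Qed.

Lemma elapsed_drop_finish j : (j < npieces (drop_piece k x))%N ->
  elapsed (drop_piece k x) j (finish_time x) = elapsed x (bump k j) (finish_time x).
Proof.
move=> jN; have jN' : (j.+1 < npieces x)%N by rewrite npieces_drop.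
rewrite -[in LHS]finish_drop elapsed_finish//; last exact: drop_piece_wf.
rewrite elapsed_finish// ?npieces_drop /bump; last first.
  by case: (leqP k j) => _; rewrite ?add1n// add0n ltnS ltnW.
rewrite (sw_drop j) [X in X - _]/=; case: (ltnP j k) => jk.
  by rewrite /= add0n; ring.
by rewrite add1n.
Qed.

(** A piece before [k] keeps its length but starts later; the others do not move. *)
Lemma elapsed_drop_le j t :
  elapsed (drop_piece k x) j t <= elapsed x (bump k j) t.
Proof.
have d0 := len_gt0; rewrite /elapsed (sw_drop j) [sw (drop_piece k x) j.+1]/= /bump.
case: (ltnP j k) => jk; last by rewrite add1n.
rewrite add0n; move: (sw x k.+1 - sw x k) d0 (sw x j) (sw x j.+1) => d d0 a b.
rewrite ge_max le_max lexx/= le_max; apply/orP; right.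
by case: (leP t b); case: (leP t (b + d)); lra.
Qed.

Lemma usage_drop f t : (pw x k = 0) -> f 0 = 0 ->
  usage f x t = \sum_(j < npieces (drop_piece k x))
    f (pw (drop_piece k x) j) * elapsed x (bump k j) t.
Proof.
move=> pk f0; rewrite /usage.
have kN' : (k < (npieces (drop_piece k x)).+1)%N by rewrite -npieces_drop.
rewrite npieces_drop (bigD1_ord (Ordinal kN'))//= pk f0 mul0r add0r.
by apply: eq_bigr.
Qed.

Lemma usage_drop_le f t : pw x k = 0 -> f 0 = 0 -> (forall p, 0 <= p -> 0 <= f p) ->
  usage f (drop_piece k x) t <= usage f x t.
Proof.
move=> pk f00 f0; rewrite usage_drop//; apply: ler_sum => j _.
rewrite ler_wpM2l ?elapsed_drop_le// f0//.
by case: drop_piece_wf => _ _; apply.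
Qed.

Lemma usage_drop_finish f : pw x k = 0 -> f 0 = 0 ->
  usage f (drop_piece k x) (finish_time x) = usage f x (finish_time x).
Proof.
move=> pk f0; rewrite usage_drop//; apply: eq_bigr => j _.
by rewrite elapsed_drop_finish.
Qed.

End DropPiece.

End PolicyTheory.

(** * Splitting the first piece, and policies without breaks *)

Section Transmission.
Variable R : realType.
Implicit Types (x : policy R) (f : R -> R) (t : R).

Lemma usage_finish f x : policy_wf x ->
  usage f x (finish_time x) = \sum_(j < npieces x) f (pw x j) * (sw x j.+1 - sw x j).
Proof. by move=> wf; apply: eq_bigr => j _; rewrite elapsed_finish. Qed.

Lemma usage_before f x t : policy_wf x -> t <= start_time x -> usage f x t = 0.
Proof.
move=> wf ts; apply: big1 => j _; rewrite elapsed_before ?mulr0//.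
by rewrite (le_trans ts)// le_sw// leq0n ltnW.
Qed.

Lemma elapsed_le x j t : sw x j <= sw x j.+1 -> elapsed x j t <= sw x j.+1 - sw x j.
Proof.
by move=> jj; rewrite /elapsed ge_max subr_ge0 jj lerD2r ge_min lexx orbT.
Qed.

(** The cut at [m] leaves the power profile unchanged. It prepares [sends_improve], which needs two
    pieces and a first piece that the energy [E 0] can pay for. *)
Definition split_first (m : R) x : policy R :=
  Policy (npieces x).+1 (fun j => pw x j.-1)
    (fun j => if j is j'.+1 then if j' is _.+1 then sw x j' else m else sw x 0).

Section SplitFirst.
Variables (x : policy R) (m : R).
Hypotheses (wf : policy_wf x) (N0 : (0 < npieces x)%N).
Hypothesis m01 : sw x 0 < m < sw x 1.

Lemma split_first_wf : policy_wf (split_first m x).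
Proof.
case/andP: m01 => m0 m1; case: wf => s0 lt_sw pw0; split=> //.
- by case=> [|[|j]]//= jN; exact: lt_sw.
- by case=> [|j] jN; [exact: pw0 | exact: pw0].
Qed.

Lemma finish_split : finish_time (split_first m x) = finish_time x.
Proof. by rewrite /finish_time /=; case: (npieces x) N0. Qed.

Lemma split_without_breaks : without_breaks x -> without_breaks (split_first m x).
Proof. by move=> pos [|j] jN; [exact: pos | exact: pos]. Qed.

Lemma usage_split f t : usage f (split_first m x) t = usage f x t.
Proof.
rewrite /usage /=; case: (npieces x) N0 => // n _.
rewrite big_ord_recl big_ord_recl [RHS]big_ord_recl/= addrA -mulrDr.
congr (_ * _ + _).
case/andP: m01; rewrite /elapsed /= => m0 m1.
move: (sw x 0) (sw x 1) m0 m1 => a b am mb.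
case: (leP t b); case: (leP t m) => ? ?.
- by case: (leP 0 (t - a)); case: (leP 0 (t - m)); lra.
- by case: (leP 0 (m - a)); case: (leP 0 (t - a)); case: (leP 0 (t - m)); lra.
- lra.
- by case: (leP 0 (m - a)); case: (leP 0 (b - m)); case: (leP 0 (b - a)); lra.
Qed.

End SplitFirst.

Variables (g : R -> R) (B0 : R) (E : R -> R).
Hypothesis rate : rate_function g.
Hypothesis B0_gt0 : 0 < B0.
Hypothesis E_mono : forall t t', t <= t' -> E t <= E t'.
Hypothesis E_gt0 : forall t, 0 <= t -> 0 < E t.

Let g0 : g 0 = 0. Proof. by case: rate => [[]]. Qed.
Let g_ge0 p : 0 <= p -> 0 <= g p. Proof. by case: rate => [[_]] h *; exact: h. Qed.

(** The part common to (P2) and OFF for policies without breaks; what remains of the receiver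
    constraints then concerns only the start and finish times. *)
Definition sends x : Prop :=
  [/\ policy_wf x, without_breaks x, bits_sent g x (finish_time x) = B0
    & forall t, 0 <= t <= finish_time x -> energy_used x t <= E t].

Lemma sends_npieces x : sends x -> (0 < npieces x)%N.
Proof.
case=> _ _ + _; rewrite /bits_sent; case: npieces => //.
by rewrite big_ord0 => /eqP; rewrite eq_sym gt_eqF.
Qed.

Lemma sends_start_lt x : sends x -> start_time x < finish_time x.
Proof.
move=> sx; have N0 := sends_npieces sx; have [wf _ _ _] := sx.
apply: (@lt_le_trans _ _ (sw x 1)); first by case: wf => _ + _; exact.
by apply: le_sw => //; rewrite N0 leqnn.
Qed.

(** Without breaks, the on-time used grows at unit rate from start to finish: it vanishes up to [o]
    only if the start is at least [o], and its total is the duration. *)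
Lemma OFF_feasibleP o G x : 0 <= o -> without_breaks x ->
  OFF_feasible g B0 E o G x <->
  [/\ sends x, o <= start_time x & finish_time x - start_time x <= G].
Proof.
move=> o0 pos; split.
- move=> [wf bits cons before].
  have energy t : 0 <= t <= finish_time x -> energy_used x t <= E t.
    move=> /andP[t0 tT]; have [to|ot] := leP t o.
      by have [|-> _] := before t; rewrite ?t0// ltW// E_gt0.
    by have [|] := cons t; rewrite ?(ltW ot).
  have sx : sends x by split.
  have sT := sends_start_lt sx.
  have os : o <= start_time x.
    rewrite leNgt; apply/negP => so.
    have s0 : 0 <= start_time x by case: wf.
    (* The minimum covers the case of a policy that finishes before [o]; in either case positive
       on-time has been used at that instant. *)
    have [] := before (Num.min o (finish_time x)).
      by rewrite le_min o0 ge_min lexx/= andbT (le_trans s0)// ltW.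
    rewrite ontime_without_breaks// => _.
    case: (leP o (finish_time x)) => h1.
      by rewrite (min_idPl h1); case: (leP 0 (o - start_time x)) => ? ?; lra.
    by rewrite minxx; case: (leP 0 (finish_time x - start_time x)) => ? ?; lra.
  split=> //; have [|_] := cons (finish_time x).
    by rewrite lexx (le_trans os)// ltW.
  rewrite ontime_without_breaks// minxx.
  by case: (leP 0 (finish_time x - start_time x)); lra.
- move=> [sx os lenG]; have [wf _ bits energy] := sx; split=> //.
  + move=> t /andP[ot tT]; rewrite energy ?tT ?(le_trans o0)//; split=> //.
    rewrite ontime_without_breaks// (min_idPl tT).
    have := sends_start_lt sx.
    by case: (leP 0 (t - start_time x)); lra.
  + move=> t /andP[t0 to]; rewrite ontime_usedE.
    rewrite /energy_used [\sum_(_ < _) _](@usage_before id)// ?usage_before//;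
      exact: le_trans to os.
Qed.

Lemma P2_feasibleP (Gam : R -> R) x : (forall t, 0 <= t -> 0 <= Gam t) ->
  without_breaks x ->
  P2_feasible g B0 E Gam x <->
  sends x /\ forall t, start_time x <= t <= finish_time x -> t - start_time x <= Gam t.
Proof.
move=> Gam0 pos; split.
- move=> [wf bits cons]; split; first by split=> // t /cons[].
  have s0 : 0 <= start_time x by case: wf.
  move=> t /andP[st tT]; have [|_] := cons t; first by rewrite tT (le_trans s0).
  rewrite ontime_without_breaks// (min_idPl tT).
  by case: (leP 0 (t - start_time x)); lra.
- move=> [[wf _ bits energy] onGam]; split=> // t /andP[t0 tT].
  rewrite energy ?t0//; split=> //; rewrite ontime_without_breaks// (min_idPl tT).
  have := Gam0 t t0; case: (leP 0 (t - start_time x)) => // ? _.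
  by apply: onGam; rewrite tT -subr_ge0; apply/andP.
Qed.

(* Each zero-power piece is dropped and everything before it is delayed
   accordingly, which can only postpone the use of energy and on-time. *)
Lemma P2_remove_breaks (Gam : R -> R) y : P2_feasible g B0 E Gam y ->
  exists z, [/\ P2_feasible g B0 E Gam z, without_breaks z
              & finish_time z = finish_time y].
Proof.
move Ey : (npieces y) => n; elim: n y Ey => [|n IH] y Ey feas.
  by exists y; split=> // j; rewrite Ey.
have [pos|] := pselect (without_breaks y); first by exists y.
move=> /existsNP[k /not_implyP[kN /negP]]; rewrite -leNgt => pk_le0.
have [wf bits cons] := feas.
have pk : pw y k = 0 by apply/le_anti; rewrite pk_le0/=; case: wf => _ _; apply.
have nd := npieces_drop kN; have Fd := finish_drop kN.
have [] := IH (drop_piece k y); first by move: nd; rewrite Ey => -[].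
  split; first exact: drop_piece_wf.
    by rewrite Fd /bits_sent [LHS](usage_drop_finish wf kN pk g0).
  move=> t; rewrite Fd => /cons[le_E le_Gam]; split.
    exact: le_trans (@usage_drop_le _ _ _ wf kN id t pk erefl _) le_E.
  apply: le_trans le_Gam; rewrite !ontime_usedE.
  by apply: usage_drop_le => //; rewrite eqxx.
by move=> z [feasz posz eqz]; exists z; split=> //; rewrite eqz.
Qed.

Definition stretch (d p e : R) x : policy R :=
  Policy (npieces x) (fun j => if j == 0%N then p else pw x j)
    (fun j => if j == 0%N then sw x 0 - d
              else if j == npieces x then sw x j - e else sw x j).

(* Sending the energy of the first piece over a longer time yields strictly
   more bits, because g(p)/p is strictly decreasing; the surplus is removed from
   the last piece. *)
Lemma sends_improve o x : 0 <= o < start_time x -> sends x ->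
  (1 < npieces x)%N -> pw x 0 * (sw x 1 - sw x 0) <= E 0 ->
  forall G, finish_time x - start_time x < G ->
  exists z, [/\ sends z, o <= start_time z, finish_time z - start_time z <= G
              & finish_time z < finish_time x].
Proof.
move=> /andP[ge0_o os] sx N1 le_E0 G lenG.
have [wf pos bits energy] := sx; have [_ lt_sw _] := wf.
have [n Nx] : exists n, npieces x = n.+2 by case: (npieces x) N1 => [|[|n]]// _; exists n.
set p := pw x 0 in le_E0 *; set l := sw x 1 - sw x 0 in le_E0 *.
pose pl := pw x n.+1; pose ll := sw x n.+2 - sw x n.+1.
have p0 : 0 < p by apply: pos; rewrite Nx.
have pl0 : 0 < pl by apply: pos; rewrite Nx.
have l0 : 0 < l by rewrite subr_gt0 lt_sw// Nx.
have ll0 : 0 < ll by rewrite subr_gt0 lt_sw// Nx.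
have gp0 := rate_gt0 rate p0; have gpl0 := rate_gt0 rate pl0.
(* The three bounds on the head start [d] keep the new start at or after [o], keep the duration
   within [G], and make [d * g p] less than the bits of the last piece; the factor 2 makes this
   strict. *)
pose d := Num.min (start_time x - o)
  (Num.min (G - (finish_time x - start_time x)) (ll * g pl / (2 * g p))).
have d0 : 0 < d.
  by rewrite !lt_min !subr_gt0 os lenG/= divr_gt0// mulr_gt0.
have dso : d <= start_time x - o by rewrite ge_min lexx.
have dG : d <= G - (finish_time x - start_time x) by rewrite !ge_min lexx orbT.
have dl : d * g p < ll * g pl.
  rewrite -ltr_pdivlMr//; apply: (@le_lt_trans _ _ (ll * g pl / (2 * g p))).
    by rewrite !ge_min lexx !orbT.
  have : ll * g pl / g p = 2 * (ll * g pl / (2 * g p)) by field; rewrite gt_eqF.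
  have : 0 < ll * g pl / (2 * g p) by rewrite divr_gt0// mulr_gt0.
  lra.
have ld0 : 0 < l + d by rewrite addr_gt0.
(* The energy [p * l] of the first piece, spread over [l + d]. *)
pose p' := p * l / (l + d).
have p'0 : 0 < p' by rewrite divr_gt0// mulr_gt0.
have p'_lt : p' < p by rewrite ltr_pdivrMr// ltr_pM2l// ltrDl.
have p'E : p' * (l + d) = p * l by rewrite mulfVK// gt_eqF.
pose surplus := g p' * (l + d) - g p * l.
have surplus0 : 0 < surplus.
  have := rate_quotient_lt rate p'0 p'_lt.
  rewrite ltr_pdivrMr// mulrAC ltr_pdivlMr// subr_gt0 -(ltr_pM2r p0) => lt_g.
  have -> : g p * l * p = g p * p' * (l + d) by rewrite -[RHS]mulrA p'E; ring.
  by rewrite [ltRHS]mulrAC ltr_pM2r.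
(* Since [p' < p], the surplus is at most what power [p] sends in the added time [d]; hence
   [e < ll], and the last piece does not disappear. *)
have le_surplus : surplus <= d * g p.
  have : g p' * (l + d) <= g p * (l + d).
    by rewrite ler_pM2r// le_rate// ltW.
  by rewrite /surplus; lra.
(* The time in which the last power sends exactly the surplus. *)
pose e := surplus / g pl.
have e0 : 0 < e by rewrite divr_gt0.
have e_ll : e < ll by rewrite ltr_pdivrMr// (le_lt_trans le_surplus).
have egpl : e * g pl = surplus by rewrite mulfVK// gt_eqF.
pose z := stretch d p' e x.
have sz0 : sw z 0 = start_time x - d by [].
have szN : finish_time z = finish_time x - e.
  by rewrite /finish_time /= Nx eqxx.
have szE j : (j.+1 < npieces x)%N -> sw z j.+1 = sw x j.+1.
  by move=> jN; rewrite /= ltn_eqF.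
have szE_le j : sw z j.+1 <= sw x j.+1.
  by rewrite /=; case: eqP => // _; rewrite gerBl ltW.
have wfz : policy_wf z.
  split=> [|[|j] jN|[|j] jN].
  - rewrite sz0; lra.
  - rewrite sz0 szE//; have : sw x 0 < sw x 1 by apply: lt_sw; rewrite Nx.
    by rewrite /start_time; lra.
  - rewrite szE//; move: jN; rewrite leq_eqVlt => /predU1P[jN|jN].
      have -> : sw z j.+2 = finish_time z by rewrite /finish_time -jN.
      rewrite szN /finish_time -jN.
      by move: jN e_ll; rewrite Nx => -[->]; rewrite /ll; lra.
    by rewrite szE// lt_sw// ltnW.
  - exact: ltW.
  - by case: wf => _ _; apply.
have posz : without_breaks z by case=> [|j] jN //; exact: pos.
exists z; split; last by rewrite szN; lra.
- split=> //.
    rewrite /bits_sent [LHS](usage_finish _ wfz) -bits [RHS](usage_finish _ wf).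
    rewrite [npieces z]/= Nx big_ord_recl big_ord_recr/=.
    rewrite [RHS]big_ord_recl [X in _ = _ + X]big_ord_recr/= /bump/= !add1n.
    rewrite Nx eqxx (ltn_eqF (isT : 1 < n.+2)%N) (ltn_eqF (ltnSn n.+1)).
    rewrite (eq_bigr (fun i : 'I_n => g (pw x (1 + i)) *
        (sw x (1 + i).+1 - sw x (1 + i)))) => [|i _]; last first.
      by rewrite !ltn_eqF// !ltnS// ltnW.
    clearbody e p'; move: egpl; rewrite /surplus /pl /l /p /=.
    move: (\sum_(i < n) _) => S; lra.
  move=> t /andP[t0 tT]; rewrite /energy_used [leLHS](_ : _ = usage id z t)//.
  have ext : usage id z t = p' * elapsed z 0 t +
      \sum_(j < n.+1) pw x j.+1 * elapsed z j.+1 t.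
    by rewrite /usage [npieces z]/= Nx big_ord_recl.
  have first_le : p' * elapsed z 0 t <= p * l.
    rewrite -p'E ler_pM2l// (le_trans (elapsed_le _ _))//.
      by rewrite ltW//; case: wfz => _ + _; apply; rewrite /= Nx.
    by rewrite sz0 szE// /l /start_time; lra.
  (* Up to [sw x 1] only the first piece is in use, and [E 0] pays for it. Afterwards [x] has spent
     that same energy too, and no later piece of [z] is ahead of the one of [x]. *)
  have [t1|t1] := leP t (sw x 1).
    rewrite ext big1 ?addr0 => [|j _].
      by rewrite (le_trans first_le)// (le_trans le_E0)// E_mono.
    rewrite elapsed_before ?mulr0// (le_trans t1)// -szE//.
    by apply: le_sw => //; rewrite /= Nx leqW.
  rewrite ext; apply: (@le_trans _ _ (energy_used x t)); last first.
    by apply: energy; rewrite t0 (le_trans tT)// szN; lra.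
  rewrite /energy_used Nx [leRHS]big_ord_recl; apply: lerD.
    rewrite (le_trans first_le)// [elapsed x _ t]elapsed_after//=.
    by rewrite (ltW t1) ltW ?lt_sw// Nx.
  apply: ler_sum => j _; rewrite lift0 ler_pM2l; last by apply: pos; rewrite Nx ltnS.
  rewrite /elapsed (szE j); last by rewrite Nx ltnS.
  have := szE_le j.+1; move: (sw z j.+2) (sw x j.+2) (sw x j.+1) => a b c ab.
  rewrite ge_max le_max lexx/= le_max; apply/orP; right.
  by rewrite lerD2r le_min ge_min lexx/= ge_min ab orbT.
- by rewrite [start_time z]sz0; lra.
- by rewrite [start_time z]sz0 szN; lra.
Qed.

(** With on-time to spare and a start after [o], a short initial piece could be stretched backwards
    by [sends_improve], which would contradict optimality. *)
Lemma OFF_optimal_start o G x : 0 <= o ->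
  optimal (OFF_feasible g B0 E o G) x -> without_breaks x ->
  finish_time x - start_time x < G -> start_time x = o.
Proof.
move=> o0 [feas opt] pos lenG.
have [sx os _] := (OFF_feasibleP G o0 pos).1 feas.
apply/le_anti; rewrite os andbT leNgt; apply/negP => lt_os.
have [wf _ bits energy] := sx; have N0 := sends_npieces sx.
have [_ lt_sw _] := wf; have l0 := lt_sw 0%N N0.
have p0 := pos 0%N N0; have E0 := E_gt0 (lexx 0).
(* Half of the first piece keeps [m] in its interior; [E 0 / pw x 0] is how long [E 0] can sustain
   its power. *)
pose m := sw x 0 + Num.min ((sw x 1 - sw x 0) / 2) (E 0 / pw x 0).
have m01 : sw x 0 < m < sw x 1.
  apply/andP; split; first by rewrite ltrDl lt_min !divr_gt0// subr_gt0.
  rewrite -ltrBrDl gt_min; apply/orP; left; lra.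
have sm : sends (split_first m x).
  split; first exact: split_first_wf.
  - exact: split_without_breaks.
  - by rewrite (finish_split _ N0) /bits_sent [LHS](usage_split N0 m01).
  - move=> t; rewrite (finish_split _ N0) => /energy.
    by rewrite /energy_used [X in _ -> is_true (X <= _)](usage_split N0 m01 id).
have first_le : pw x 0 * (m - sw x 0) <= E 0.
  by rewrite /m addrC addKr mulrC -ler_pdivlMr// ge_min lexx orbT.
have oos : 0 <= o < start_time (split_first m x) by rewrite o0.
have N1 : (1 < npieces (split_first m x))%N by rewrite /= ltnS.
have [|z [sz oz lenz]] := sends_improve oos sm N1 first_le (G := G).
  by rewrite (finish_split _ N0).
rewrite (finish_split _ N0) ltNge => /negP; apply; apply: opt.
by apply/(OFF_feasibleP _ o0); case: sz.
Qed.

End Transmission.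

(** * The problems OFF(O_i) and their relation to (P2) *)

Section OFFM.
Variables (R : realType) (tau en r gam : nat -> R) (g : R -> R) (B0 : R).
Variables (O : nat -> R) (X : nat -> option (policy R)).
Hypotheses (arrE : arrival_process tau en) (arrG : arrival_process r gam).
Hypotheses (rate : rate_function g) (B0_gt0 : 0 < B0).
Let E := cumulative tau en.
Let Gam := cumulative r gam.
Hypothesis earliest : forall i, earliest_on_time Gam r i (O i).
Hypothesis subroutine : OFF_subroutine g B0 E Gam r O X.

Let E_mono t t' : t <= t' -> E t <= E t'. Proof. exact: le_cumulative. Qed.
Let E_gt0 t : 0 <= t -> 0 < E t. Proof. exact: cumulative_gt0. Qed.
Let Gam_mono t t' : t <= t' -> Gam t <= Gam t'. Proof. exact: le_cumulative. Qed.
Let Gam_gt0 t : 0 <= t -> 0 < Gam t. Proof. exact: cumulative_gt0. Qed.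
Let Gam_ge0 t : 0 <= t -> 0 <= Gam t. Proof. by move=> /Gam_gt0/ltW. Qed.
Let r0 : r 0%N = 0. Proof. by case: arrG. Qed.
Let r_ge0 i : 0 <= r i. Proof. by rewrite -r0 (arrival_time_le arrG). Qed.
Let O_ge0 i : 0 <= O i. Proof. by have [[]] := earliest i. Qed.

Let OFF := fun i => OFF_feasible g B0 E (O i) (Gam (r i)).
Let P2 := P2_feasible g B0 E Gam.

Lemma OFFP i x : without_breaks x -> OFF i x <->
  [/\ sends g B0 E x, O i <= start_time x & finish_time x - start_time x <= Gam (r i)].
Proof. by move=> pos; apply: OFF_feasibleP. Qed.

Lemma P2P x : without_breaks x -> P2 x <-> sends g B0 E x /\
  forall t, start_time x <= t <= finish_time x -> t - start_time x <= Gam t.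
Proof. by move=> pos; apply: P2_feasibleP. Qed.

(** Staying on for the larger amount [Gam (r i.+1)] includes staying on for [Gam (r i)], so [O i.+1]
    is a candidate for index [i]. *)
Lemma earliest_le_succ i : O i <= O i.+1.
Proof.
have [_ lb] := earliest i; have [[ge0_O on] _] := earliest i.+1; apply: lb.
split=> // t /andP[ge_t tO]; apply: on; rewrite ge_t (le_trans tO)// lerD2l.
by apply/ltW/(cumulative_arrival_lt arrG).
Qed.

Lemma earliest_le i j : (i <= j)%N -> O i <= O j.
Proof. by apply: (homo_leq (@lexx _ _) (@le_trans _ _)); exact: earliest_le_succ. Qed.

(** A receiver switched on any earlier would exhaust [Gam (r i)] before the next arrival at
    [r i.+1]. *)
Lemma earliest_ge i : r i.+1 - Gam (r i) <= O i.+1.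
Proof.
have [[ge0_O on] _] := earliest i.+1; rewrite leNgt; apply/negP => lt_O.
have ltG : Gam (r i) < Gam (r i.+1) := cumulative_arrival_lt arrG i.
have rGO : O i.+1 + Gam (r i) < r i.+1 by lra.
(* [t] is taken after [Gam (r i)] runs out, but before both the next arrival and the end of the
   required on-interval. *)
pose b := Num.min (r i.+1) (O i.+1 + Gam (r i.+1)).
have ab : O i.+1 + Gam (r i) < b by rewrite lt_min rGO ltrD2l.
pose t := (O i.+1 + Gam (r i) + b) / 2.
have at_ : O i.+1 + Gam (r i) < t by rewrite /t; lra.
have tb : t < b by rewrite /t; lra.
have := tb; rewrite lt_min => /andP[t_r t_O].
have Gt : Gam t <= Gam (r i) := cumulative_before arrG t_r.
have Gi := Gam_gt0 (r_ge0 i).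
have : t - O i.+1 <= Gam t by apply: on; rewrite (ltW t_O) andbT; lra.
lra.
Qed.

(** Up to [O i + Gam (r i)], starting later than [O i] only saves on-time. Beyond it, the whole
    duration is at most [Gam (r i)], which has already been harvested by then. *)
Lemma OFF_P2 i x : without_breaks x -> OFF i x -> P2 x.
Proof.
move=> pos /(OFFP i pos)[sx Os lenG]; apply/(P2P pos); split=> // t /andP[st tT].
have [[ge0_O on] _] := earliest i.
have [tO|Ot] := leP t (O i + Gam (r i)).
  have : t - O i <= Gam t by apply: on; rewrite tO andbT (le_trans Os).
  lra.
have : O i + Gam (r i) - O i <= Gam (O i + Gam (r i)).
  by apply: on; rewrite lexx andbT lerDl Gam_ge0.
have := Gam_mono (ltW Ot); lra.
Qed.

(** By Jensen's inequality, no policy of duration at most [G] beats constant power over [G] with all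
    the energy available by the finish time. *)
Lemma sends_bits_le x G : sends g B0 E x -> 0 < G ->
  finish_time x - start_time x <= G -> B0 <= G * g (E (finish_time x) / G).
Proof.
move=> sx G0 lenG; have [wf pos bits energy] := sx.
have lt_sT := sends_start_lt B0_gt0 sx.
have T0 : 0 <= finish_time x by case: wf => + _ _ => /le_trans; apply; exact: ltW.
have U_E := energy _ (introT andP (conj T0 (lexx _))).
have {}U_E : usage id x (finish_time x) <= E (finish_time x) := U_E.
rewrite -bits [leLHS](usage_finish g wf).
have len : \sum_(j < npieces x) (sw x j.+1 - sw x j) <= G.
  rewrite (eq_bigr (fun j : 'I__ => elapsed x j (finish_time x))) => [|j _]; last first.
    by rewrite elapsed_finish.
  rewrite sum_elapsed// -/(finish_time x) minxx.
  by rewrite (max_idPr _) ?subr_ge0 ?(ltW lt_sT).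
have [_ lt_sw pw0] := wf.
have d0 j : (j < npieces x)%N -> 0 <= sw x j.+1 - sw x j.
  by move=> jN; rewrite subr_ge0 ltW// lt_sw.
apply: le_trans (rate_jensen rate G0 pw0 d0 len) _.
rewrite ler_pM2l// le_rate// ?ler_pM2r ?invr_gt0//.
  by rewrite divr_ge0 ?(ltW G0)// sumr_ge0// => j _; rewrite mulr_ge0 ?pw0 ?d0.
by rewrite -(usage_finish id wf).
Qed.

(** For the least [j] such that [Gam (r j)] covers the duration, the receiver can stay on for
    [Gam (r j)] from the start of [x], so [O j] is no later than this start. *)
Lemma P2_OFF x : without_breaks x -> P2 x ->
  exists j, enough_bits g B0 E Gam r j /\ OFF j x.
Proof.
move=> pos /(P2P pos)[sx on]; have [[s0 _ _] _ _ _] := sx.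
have lt_sT := sends_start_lt B0_gt0 sx.
have ex : exists j, finish_time x - start_time x <= Gam (r j).
  have [m rm] := arrival_time_unbounded arrG (finish_time x); exists m.
  apply: le_trans (on _ _) _; first by rewrite lexx ltW.
  by apply: Gam_mono; rewrite ltW// rm.
exists (ex_minn ex); case: ex_minnP => j lenG min_j; split.
  have T0 : 0 <= finish_time x by rewrite (le_trans s0)// ltW.
  have Gj := Gam_gt0 (r_ge0 j).
  by apply: (enough_bitsP rate arrE Gj T0); apply: (sends_bits_le sx).
apply/(OFFP j pos); split=> //; have [_ lb] := earliest j; apply: lb.
split=> // t /andP[st tG]; have [tT|Tt] := leP t (finish_time x).
  by apply: on; rewrite st.
apply: (@le_trans _ _ (Gam (r j))); first by lra.
(* It remains to see that [r j] has passed. If [r j.+1] came after the finish time, [Gam (r j)]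
   would already cover the duration, against minimality. *)
apply: Gam_mono; case: j min_j {lenG tG} => [|j] min_j.
  by rewrite r0 (le_trans s0).
rewrite (le_trans _ (ltW Tt))// leNgt; apply/negP => T_r.
suff /min_j : finish_time x - start_time x <= Gam (r j) by rewrite ltnn.
apply: le_trans (on _ _) _; first by rewrite lexx ltW.
exact: cumulative_before.
Qed.

Lemma OFF_P2_finish y : P2 y -> exists j x, [/\ enough_bits g B0 E Gam r j,
  without_breaks x, OFF j x & finish_time x = finish_time y].
Proof.
move=> /(P2_remove_breaks rate)[z [feas pos eq_T]].
by have [j [enough off]] := P2_OFF pos feas; exists j, z.
Qed.

Lemma first_index_exists i : enough_bits g B0 E Gam r i ->
  exists i0, first_index g B0 E Gam r i0.
Proof.
move=> enough.
have ex : exists i, `[< enough_bits g B0 E Gam r i >] by exists i; apply/asboolP.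
exists (ex_minn ex); case: ex_minnP => j /asboolP enough_j min_j.
by split=> // k enough_k; apply: min_j; apply/asboolP.
Qed.

Let stops := stop_at O X.

(** * The loop started at the first index: termination and comparison of finish times *)

Section FromFirstIndex.
Variable i0 : nat.
Hypothesis first : first_index g B0 E Gam r i0.

Lemma subroutine_some i x : (i0 <= i)%N -> X i = Some x ->
  optimal (OFF i) x /\ without_breaks x.
Proof. by move=> ii Xi; have := subroutine first ii; rewrite Xi. Qed.

(** The feasible [y] rules out the answer [None]. *)
Lemma subroutine_le i y : (i0 <= i)%N -> OFF i y ->
  exists2 x, X i = Some x & finish_time x <= finish_time y.
Proof.
move=> ii offy; have := subroutine first ii.
case Xi: (X i) => [x|]; last by case; exists y.
by move=> [[_ opt] _]; exists x => //; exact: opt.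
Qed.

Lemma no_stop_start i x : (forall y, ~ stops i y) -> X i = Some x ->
  O i.+1 < start_time x.
Proof. by move=> no Xi; rewrite ltNge; apply/negP => le_O; apply: (no x). Qed.

Lemma no_stop_step i x : (i0 <= i)%N -> (forall y, ~ stops i y) -> X i = Some x ->
  exists2 x', X i.+1 = Some x' & finish_time x' <= finish_time x.
Proof.
move=> ii no Xi; have lt_O := no_stop_start no Xi.
have [[feas _] pos] := subroutine_some ii Xi.
have [sx _ lenG] := (OFFP i pos).1 feas.
apply: subroutine_le; first exact: leqW.
apply/(OFFP _ pos); split=> //; first exact: ltW.
by rewrite (le_trans lenG)// ltW// (cumulative_arrival_lt arrG).
Qed.

Lemma no_stop_steps i j x : (i0 <= j <= i)%N ->
  (forall k, (j <= k < i)%N -> forall y, ~ stops k y) -> X j = Some x ->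
  exists2 x', X i = Some x' & finish_time x' <= finish_time x.
Proof.
move=> /andP[i0j]; elim: i => [|i IH].
  by rewrite leqn0 => /eqP -> _ Xj; exists x.
rewrite leq_eqVlt => /predU1P[-> _ Xj|]; first by exists x.
rewrite ltnS => ji no Xj.
have [|x' Xi le_x] := IH ji _ Xj.
  by move=> k /andP[jk ki]; apply: no; rewrite jk ltnW.
have [||x'' Xi' le_x'] := no_stop_step _ _ Xi; first exact: leq_trans ji.
  by apply: no; rewrite ji ltnSn.
by exists x'' => //; exact: le_trans le_x.
Qed.

(* If the loop ran forever, the starts O_{i+1} < start X_i would stay below a
   fixed finish time T; since r_{i+1} - Gam(r_i) <= O_{i+1}, the on-time Gam(r_i)
   would then exceed T, and X_i would have started at O_i already. *)
Lemma OFFM_stops j z : (i0 <= j)%N -> X j = Some z -> exists2 i, (i0 <= i)%N &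
  exists x, stops i x.
Proof.
move=> i0j Xj; apply: contrapT => never.
have no i : (i0 <= i)%N -> forall y, ~ stops i y.
  by move=> ii y st; apply: never; exists i => //; exists y.
(* As [O i.+1] is below the finish time of [z], an arrival [r i.+1] beyond twice that time forces
   [Gam (r i)] above it, hence above the duration of [X i]. *)
have [m rm] := arrival_time_unbounded arrG (2 * finish_time z).
pose i := maxn j m.
have ji : (j <= i)%N by rewrite leq_maxl.
have ii : (i0 <= i)%N := leq_trans i0j ji.
have ri : 2 * finish_time z < r i.+1 by apply: rm; rewrite leqW// leq_maxr.
have [|k /andP[jk _]|x Xi le_x] := @no_stop_steps i j z _ _ Xj.
- by rewrite i0j.
- by apply: no; exact: leq_trans jk.
have lt_O := no_stop_start (no _ ii) Xi.
have [[feas opt] pos] := subroutine_some ii Xi.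
have [sx _ _] := (OFFP i pos).1 feas; have lt_sT := sends_start_lt B0_gt0 sx.
have [[s0 _ _] _ _ _] := sx; rewrite -/(start_time x) in s0.
have ge_O := earliest_ge i; have O0 := O_ge0 i.+1.
have eq_O : start_time x = O i.
  apply: (OFF_optimal_start rate B0_gt0 E_mono E_gt0 (O_ge0 i) _ pos).
    by split; [exact: feas | exact: opt].
  by rewrite -/Gam; lra.
(* The start of [X i] equals [O i], which is at most [O i.+1], yet it also exceeds [O i.+1]. *)
by have := earliest_le_succ i; lra.
Qed.

Lemma stops_le i x j y : (i0 <= i)%N -> (i < j)%N -> stops i x ->
  X j = Some y -> finish_time x <= finish_time y.
Proof.
move=> ii ij [Xi le_O] Xj.
have [[feasx optx] posx] := subroutine_some ii Xi.
have [[feasy _] posy] := subroutine_some (leq_trans ii (ltnW ij)) Xj.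
have [sx _ lenx] := (OFFP i posx).1 feasx; have [sy Oy _] := (OFFP j posy).1 feasy.
(* One copy of the assumption is to be refuted; the other shows [y] to be shorter than [x], hence
   within the budget [Gam (r i)]. *)
rewrite leNgt; apply/negP => lt_yx; have := lt_yx.
rewrite ltNge => /negP; apply.
have OO := earliest_le ij; have OO' := earliest_le_succ i.
by apply: optx; apply/(OFFP i posy); split=> //; lra.
Qed.

(** The derivation is built backwards from the stopping index, by induction on the distance [n] to
    it. *)
Lemma OFFM_loop_stops i x : (i0 <= i)%N -> stops i x ->
  (forall k, (i0 <= k < i)%N -> forall y, ~ stops k y) -> OFFM_loop O X i0 x.
Proof.
move=> ii st no; suff H n : (n <= i - i0)%N -> OFFM_loop O X (i - n) x.
  by have := H _ (leqnn _); rewrite subKn.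
elim: n => [_|n IH le_n]; first by rewrite subn0; exact: OFFM_output.
have ni : (n < i)%N := leq_trans le_n (leq_subr _ _).
apply: OFFM_next; last by rewrite subnSK//; apply: IH; exact: ltnW.
apply: no; rewrite leq_subRL// addnC -leq_subRL// le_n ltn_subrL/=.
exact: leq_trans ni.
Qed.

End FromFirstIndex.

Lemma OFFM_correct : (exists y, P2 y) ->
  exists x, OFFM_returns g B0 E Gam r O X x /\ optimal P2 x.
Proof.
move=> [y0 /OFF_P2_finish[j [z [enough posz offz _]]]].
have [i0 first] := first_index_exists enough.
have ge_i0 k : enough_bits g B0 E Gam r k -> (i0 <= k)%N by case: first => _; apply.
have [z' Xj _] := subroutine_le first (ge_i0 _ enough) offz.
have [k i0k [xk stk]] := OFFM_stops first (ge_i0 _ enough) Xj.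
(* The loop outputs at the least stopping index, so that one is selected. *)
have ex : exists i, (i0 <= i)%N && `[< exists x, stops i x >].
  by exists k; rewrite i0k; apply/asboolP; exists xk.
have [i ii [x st] min_i] : exists2 i, (i0 <= i)%N & exists2 x, stops i x &
    forall k, (i0 <= k < i)%N -> forall y, ~ stops k y.
  case: (ex_minnP ex) => i /andP[ii /asboolP[x st]] min_i; exists i => //.
  exists x => // l /andP[i0l li] y sty.
  have := min_i l; rewrite i0l leqNgt li => H; suff : false by [].
  by apply: H; apply/asboolP; exists y.
have [Xi _] := st; have [[feas opt] pos] := subroutine_some first ii Xi.
exists x; split; first by exists i0 => //; exact: OFFM_loop_stops st min_i.
split=> [|y /OFF_P2_finish[l [w [/ge_i0 i0l posw offw <-]]]]; first exact: OFF_P2 feas.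
have [w' Xl le_w] := subroutine_le first i0l offw; apply: le_trans le_w.
(* An index after the stop is handled by [stops_le]; up to the stop, finish times do not increase
   along the loop. *)
have [il|li] := ltnP i l; first exact: (stops_le first ii il st Xl).
have [|m /andP[lm mi]|x'] := @no_stop_steps _ first i l w' _ _ Xl.
- by rewrite i0l.
- by apply: min_i; rewrite mi (leq_trans i0l).
by rewrite Xi => -[->].
Qed.

End OFFM.

Theorem theorem3 (R : realType) (tau en r gam : nat -> R) (g : R -> R) (B0 : R)
  (O : nat -> R) (X : nat -> option (policy R)) :
  arrival_process tau en ->
  arrival_process r gam ->
  rate_function g ->
  0 < B0 ->
  (forall i, earliest_on_time (cumulative r gam) r i (O i)) ->
  OFF_subroutine g B0 (cumulative tau en) (cumulative r gam) r O X ->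
  (exists x, P2_feasible g B0 (cumulative tau en) (cumulative r gam) x) ->
  exists x,
    OFFM_returns g B0 (cumulative tau en) (cumulative r gam) r O X x /\
    optimal (P2_feasible g B0 (cumulative tau en) (cumulative r gam)) x.
Proof. by move=> arrE arrG rate B0_gt0; exact: OFFM_correct. Qed.
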